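(* Let $q>1$ be a real number and let $d>1$ be an integer. For every positive integer $n$ there exists $N=N(d,n,q)$ with the following property. If $a$ is a $d$-dimensional sequence of length $N$ in general position, then there exists an invertible $d\times d$ real matrix $T$ such that the sequence $Ta=(Ta_1,\dots,Ta_N)$ has a $q$-pseudo-geometric subsequence of length $n$. Furthermore, $T$ can be chosen to be lower triangular.
   Context: Write $[n]=\{1,\dots,n\}$. A $d$-dimensional sequence of length $n$ is a map $a:[n]\to\mathbb{R}^d$, with elements (column vectors) $a_i=(a_{1,i},\dots,a_{d,i})^T$; its $s$-th coordinate sequence is $a_{s,1},a_{s,2},\dots,a_{s,n}$. It is in general position if any $d$ of its elements (at distinct indices) are linearly independent. A subsequence of length $n'$ is $a_{i_1},\dots,a_{i_{n'}}$ with $i_1<\dots<i_{n'}$. A real sequence $c_1,\dots,c_n$ is $q$-increasing (for $q>1$) if all its terms are positive and $c_{i+1}/c_i>q$ for every $i\in[n-1]$. A $d$-dimensional sequence $a$ ($d>1$) is $q$-pseudo-geometric if all coordinate sequences are positive and for all distinct $s,t\in[d]$, one of the two sequences $(a_{t,i}/a_{s,i})_i$, $(a_{s,i}/a_{t,i})_i$ is $q$-increasing. *)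

(* Defs.v *)
From HB Require Import structures.
From mathcomp Require Import all_boot all_order all_algebra.
From mathcomp Require Import reals.

Set Implicit Arguments.
Unset Strict Implicit.
Unset Printing Implicit Defensive.

Import Order.TTheory GRing.Theory Num.Theory.
Local Open Scope ring_scope.

(* A d-dimensional sequence of length n, with indices and coordinates
   numbered from 0; the s-th coordinate of the i-th element is [a i s 0]. *)
Definition dseq (R : realType) (d n : nat) : Type := 'I_n -> 'cV[R]_d.

(* The injection f selects the d distinct indices. *)
Definition general_position (R : realType) (d n : nat) (a : dseq R d n) : Prop :=
  forall f : 'I_d -> 'I_n, injective f -> free [seq a (f i) | i : 'I_d].

Definition subsequence (R : realType) (d m n : nat)
    (b : dseq R d m) (a : dseq R d n) : Prop :=
  exists2 f : 'I_m -> 'I_n,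
    {homo f : i j / (i < j)%N} & forall i, b i = a (f i).

Definition q_increasing (R : realType) (q : R) (n : nat) (c : 'I_n -> R) : Prop :=
  (forall i, 0 < c i) /\
  (forall i j : 'I_n, j = i.+1 :> nat -> q < c j / c i).

Definition pseudo_geometric (R : realType) (q : R) (d n : nat)
    (a : dseq R d n) : Prop :=
  (forall s i, 0 < a i s 0) /\
  (forall s t : 'I_d, s != t ->
     q_increasing q (fun i => a i t 0 / a i s 0) \/
     q_increasing q (fun i => a i s 0 / a i t 0)).

(* Main.v *)
Require Import Defs.
From HB Require Import structures.
From mathcomp Require Import all_boot all_order all_algebra.
From mathcomp Require Import reals.
From mathcomp Require Import zify ring lra.

Set Implicit Arguments.
Unset Strict Implicit.
Unset Printing Implicit Defensive.

Import Order.TTheory GRing.Theory Num.Theory.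
Local Open Scope ring_scope.

(** The rows of [T] are linear forms, and the sequence turns each form [v] into
    a real sequence, written [ev x v] below.  If the sequence were infinite,
    one would work with growth rates along a subsequence: to a
    list of forms with pairwise different rates one adds the next coordinate
    [f], and as long as [f] has the same rate as one of the older forms one
    subtracts the right multiple of that form, which lowers the rate.  Since [f]
    only receives multiples of older forms, the matrix stays triangular.  In a
    finite sequence there are no limits, and the right multiples have to be found
    by interpolation together with Ramsey's theorem.

    Let [h 0, ..., h (k-1)] be the forms found so far, listed by rate: each ratio
    [h (t+1) / h t] grows by a large factor [K * K] at every step
    ([separated]).  For a set [Z] of [k] indices let [interp Z] be the element of
    [f + span h] that vanishes on [Z].  The right multiples are those of
    [g = interp Z], where [m] points of [Z] lie to the left and [k - m] to the right
    of the part of the sequence that is kept; call this pattern [m].  Then [m] will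
    be the rank of [g] among the [h t].  (If [h t] and [f] are powers of one fast growing sequence,
    this [g] is close to [f] on the middle part exactly when [m] forms grow
    more slowly than [f].)

    It remains to find [m].  By [ramsey], the sign of [g x], and whether [g]
    outgrows [h (m-1)] and whether [g] is outgrown by [h m], each by the factor
    [K * K] between two indices of the middle part, may be assumed to depend on [m] only.
    The central claim ([growth_or_decay]) is that for each [j < k] either
    pattern [j+1] gives a [g] that outgrows [h j], or pattern [j] gives a [g] that
    is outgrown by [h j].  To see this, fix a set [Z0] of [j] points on the left
    and [k-1-j] on the right and let one more root [y] vary.  All forms [interp (Z0 + y)] differ
    by multiples of a single form [H] in the span of [h] with roots [Z0], and the
    generalized Vandermonde matrix of the [h t] is so dominated by its
    diagonal that [H] is, up to a factor [3], a multiple of [h j] on the middle part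
    ([comb_dominance]).  Hence [interp (Z0 + y) x / H x = rho x - rho y] for one
    function [rho], which is monotone because signs are uniform.  If both
    alternatives fail, then all differences of [rho] with a common left end are
    comparable, and so are all those with a common right end, so every
    step of [rho] is at least a fixed fraction of its total variation, which is
    impossible on a long list ([no_flat_growth]).

    Now let [m] be the least number such that [m = k] or pattern [m] is outgrown
    by [h m].  If [m > 0], then pattern [m-1] is not outgrown by [h (m-1)], so by the
    claim pattern [m] outgrows [h (m-1)], and [g] can be inserted at rank [m]. *)

(** * Ramsey's theorem for lists *)

Section Ramsey.
Variables (T : eqType) (C : finType).
Local Open Scope nat_scope.

Definition homogeneous (r : nat) (col : seq T -> C) (c : C) (X : seq T) :=
  forall w, subseq w X -> size w = r -> col w = c.

(** The intermediate stage in the induction step of Ramsey's theorem: the color of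
    a word is decided by its first letter, and the list records which color that is. *)
Fixpoint head_colored (r : nat) (col : seq T -> C) (Y : seq (T * C)) : Prop :=
  if Y is (x, c) :: Y' then
    homogeneous r (fun w => col (x :: w)) c (map fst Y') /\ head_colored r col Y'
  else True.

Lemma homogeneous_sub r col c X Y :
  subseq Y X -> homogeneous r col c X -> homogeneous r col c Y.
Proof. by move=> sYX hX w swY; apply: hX; apply: subseq_trans sYX. Qed.

(** Once first letters decide colors, keeping the letters that announce the same
    color makes all colors equal. *)
Lemma head_colored_filter r col Y c : head_colored r col Y ->
  homogeneous r.+1 col c (map fst [seq y <- Y | y.2 == c]).
Proof.
elim: Y => [|[x e] Y IH] /=; first by move=> _ [|y w].
case=> hx /IH{}IH; case: eqP => [ec | _] //= [|y w] //=; rewrite -ec in IH *.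
case: eqP => [-> sw [sz] | _ sw sz]; last exact: IH.
apply: hx sz; apply: subseq_trans sw _; apply: map_subseq; exact: filter_subseq.
Qed.

Lemma pigeonhole_color n (Y : seq (T * C)) : #|C| * n < size Y ->
  exists c, n <= size [seq y <- Y | y.2 == c].
Proof.
move=> big; apply/existsP; apply: contraLR big => /existsPn small.
rewrite -leqNgt -sum1_size (partition_big snd xpredT) //=.
apply: leq_trans (_ : \sum_(c : C) n <= _); last by rewrite sum_nat_const.
apply: leq_sum => c _; move: (small c).
by rewrite -ltnNge size_filter -sum1_count => /ltnW.
Qed.

(** Greedy construction: the first letter turns the coloring of words of size
    [r+1] into one of words of size [r]; the next letters are taken from a list
    homogeneous for that one. *)
Lemma ramsey_heads r :
  (forall n, exists N, forall (col : seq T -> C) X, N <= size X ->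
     exists c Y, [/\ subseq Y X, size Y = n & homogeneous r col c Y]) ->
  forall n, exists N, forall (col : seq T -> C) X, N <= size X ->
     exists Y, [/\ subseq (map fst Y) X, size Y = n & head_colored r col Y].
Proof.
move=> ramsey_r; elim=> [|n [N1 IH]].
  by exists 0 => col X _; exists [::]; rewrite sub0seq.
have [N2 hN2] := ramsey_r N1; exists N2.+1 => col [|x X] //= szX.
have [c [Y [sYX szY hY]]] := hN2 (fun w => col (x :: w)) X szX.
have [|Z [sZY szZ hZ]] := IH col Y; first by rewrite szY.
exists ((x, c) :: Z) => /=; rewrite eqxx szZ; split=> //.
  exact: subseq_trans sYX.
by split=> //; apply: homogeneous_sub hY.
Qed.

Theorem ramsey r n : exists N, forall (col : seq T -> C) X, N <= size X ->
  exists c Y, [/\ subseq Y X, size Y = n & homogeneous r col c Y].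
Proof.
elim: r n => [|r IH] n.
  exists n => col X szX; exists (col [::]), (take n X).
  by rewrite take_subseq size_takel //; split=> // w _ /size0nil->.
have [N hN] := ramsey_heads IH (#|C| * n).+1; exists N => col X szX.
have [Y [sYX szY hY]] := hN col X szX.
have [|c hc] := @pigeonhole_color n Y; first by rewrite szY.
set Z := map fst [seq y <- Y | y.2 == c].
have sZ : subseq (take n Z) Z by apply: take_subseq.
exists c, (take n Z); split.
- apply: subseq_trans sZ _; apply: subseq_trans sYX.
  by apply: map_subseq; apply: filter_subseq.
- by rewrite size_takel // size_map.
- by apply: homogeneous_sub sZ _; apply: head_colored_filter.
Qed.

End Ramsey.

(** * Dominance of the diagonal in generalized Vandermonde systems *)

Section Dominance.
Variables (R : realFieldType) (k : nat) (K : R) (h : nat -> nat -> R).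
Hypothesis K1 : 1 <= K.
Hypothesis K4 : 4 * k%:R <= K.
Hypothesis h_gt0 : forall t i, (t < k)%N -> (i < k)%N -> 0 < h t i.
Hypothesis h_sep : forall t i j, (t.+1 < k)%N -> (i < j)%N -> (j < k)%N ->
  K * K * h t.+1 i * h t j < h t.+1 j * h t i.

(** In this section [h t i] stands for the value of the [t]-th function at the
    [i]-th of [k] increasing points.  The weights rescale the functions so that
    [weight t * h t] and [weight t.+1 * h t.+1] cross between the points [t] and
    [t.+1]: the second is [K] times smaller at point [t], hence at least [K] times
    larger at point [t.+1] because the ratio grows by [K * K]. *)
Fixpoint weight (t : nat) : R :=
  if t is t'.+1 then weight t' * (h t' t' / (K * h t'.+1 t')) else 1.

Let K0 : 0 < K. Proof. by apply: lt_le_trans K1. Qed.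

Lemma weight_gt0 t : (t < k)%N -> 0 < weight t.
Proof.
elim: t => [|t IH] tk //=; have tk' := ltnW tk.
by rewrite mulr_gt0 ?IH // divr_gt0 ?mulr_gt0 ?h_gt0.
Qed.

Lemma weight_up t i : (t < i)%N -> (i < k)%N ->
  K * (weight t * h t i) <= weight t.+1 * h t.+1 i.
Proof.
move=> ti ik /=; have tk := ltn_trans ti ik; have t1k := leq_ltn_trans ti ik.
rewrite mulrCA -mulrA ler_pM2l ?weight_gt0 //.
rewrite mulrAC ler_pdivlMr ?mulr_gt0 ?h_gt0 // [leRHS]mulrC.
have := h_sep t1k ti ik; nra.
Qed.

Lemma weight_down t i : (t.+1 < k)%N -> (i <= t)%N ->
  K * (weight t.+1 * h t.+1 i) <= weight t * h t i.
Proof.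
move=> tk it /=; have tk' := ltnW tk; have ik := leq_ltn_trans it tk'.
rewrite -mulrA mulrCA ler_pM2l ?weight_gt0 //.
have p1 := h_gt0 tk tk'; have p2 := h_gt0 tk ik; have p3 := h_gt0 tk' tk'.
have p4 := h_gt0 tk' ik.
rewrite invfM [X in X <= _](_ : _ = h t t * h t.+1 i / h t.+1 t); last first.
  by field; rewrite !gt_eqF.
rewrite ler_pdivrMr //; move: it; rewrite leq_eqVlt => /orP[/eqP-> // | it].
have := h_sep tk it tk'.
have : h t.+1 i * h t t <= K * K * h t.+1 i * h t t.
  rewrite -[K * K * _ * _]mulrA ler_peMl ?mulr_ge0 ?(ltW p2) ?(ltW p3) //.
  by rewrite (le_trans K1) // ler_peMl // ltW.
nra.
Qed.

(** At point [i] the rescaled functions increase with their index up to [i] and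
    decrease afterwards, each time at least by a factor [K]. *)
Lemma weight_dominant t i : (t < k)%N -> (i < k)%N -> t != i ->
  K * (weight t * h t i) <= weight i * h i i.
Proof.
move=> tk ik; have pos s : (s < k)%N -> 0 <= weight s * h s i.
  by move=> sk; rewrite mulr_ge0 ?ltW ?h_gt0 ?weight_gt0.
rewrite neq_ltn => /orP[ti | it].
  have [n def_i] : exists n, i = (t + n.+1)%N by exists (i - t.+1)%N; lia.
  elim: n t def_i {tk ti} => [|n IH] t def_i.
    by rewrite {2 3}def_i addn1; apply: weight_up; lia.
  apply: le_trans (IH t.+1 _); last by lia.
  apply: le_trans (weight_up _ _) _; try lia.
  by rewrite ler_peMl ?pos //; lia.
have [n def_t] : exists n, t = (i + n.+1)%N by exists (t - i.+1)%N; lia.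
elim: n t def_t {it} tk => [|n IH] t def_t tk.
  by rewrite def_t addn1 in tk *; apply: weight_down.
rewrite def_t addnS in tk *; apply: le_trans (weight_down _ _) _; try lia.
apply: le_trans (IH (i + n.+1)%N erefl _); last by lia.
by rewrite ler_peMl ?pos //; lia.
Qed.

(** In terms of the rescaled coefficients [g], the equation at a point [i != j]
    says that [g i] is at most the sum of all coefficients divided by [K].  As
    [K >= 4 k], the coefficient [g j] carries at least half of that sum, and at
    point [j] the other functions are at least [K] times smaller. *)
Lemma kernel_dominance (c : 'I_k -> R) (j : 'I_k) :
  (forall i : 'I_k, i != j -> \sum_t c t * h t i = 0) ->
  2 * \sum_(t | t != j) `|c t| * h t j <= `|c j| * h j j.
Proof.
move=> c0; pose g (t : 'I_k) : R := `|c t| / weight t.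
have wgt0 (t : 'I_k) : 0 < weight t by apply: weight_gt0.
have hgt0 (t i : 'I_k) : 0 < h t i by apply: h_gt0.
have gge0 t : 0 <= g t by rewrite divr_ge0 // ltW.
have cE t : `|c t| = g t * weight t by rewrite mulfVK // gt_eqF.
have off (i : 'I_k) : K * \sum_(t | t != i) `|c t| * h t i <=
    (\sum_t g t) * (weight i * h i i).
  rewrite mulr_sumr mulr_suml [leRHS](bigID (fun t => t != i)) /=.
  rewrite ler_wpDr ?sumr_ge0 // => [t _|].
    by rewrite mulr_ge0 // mulr_ge0 // ltW.
  apply: ler_sum => t ti; rewrite cE -mulrA mulrCA.
  by rewrite ler_wpM2l // weight_dominant.
have gsmall i : i != j -> K * g i <= \sum_t g t.
  move=> ij; rewrite -(ler_pM2r (_ : 0 < weight i * h i i)) ?mulr_gt0 //.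
  apply: le_trans _ (off i); rewrite -mulrA ler_pM2l // mulrA -cE.
  have /eqP := c0 i ij; rewrite (bigD1 i) //= addr_eq0 => /eqP ci.
  rewrite -[h i i]gtr0_norm // -normrM ci normrN.
  apply: le_trans (ler_norm_sum _ _ _) _; apply: ler_sum => t _.
  by rewrite normrM [`|h _ _|]gtr0_norm.
have : K * \sum_(i | i != j) g i <= k%:R * \sum_t g t.
  rewrite mulr_sumr; apply: le_trans (ler_sum _ gsmall) _.
  rewrite sumr_const -[leLHS]mulr_natl ler_wpM2r ?sumr_ge0 // ler_nat.
  by rewrite -[X in (_ <= X)%N]card_ord max_card.
have k1 : 1 <= k%:R :> R by rewrite (ler_nat _ 1%N) (leq_ltn_trans (leq0n j)).
have := off j; rewrite [\sum_t g t](bigD1 j) //= => offj.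
have rest0 : 0 <= \sum_(i | i != j) g i by rewrite sumr_ge0.
rewrite cE.
set s := \sum_(i | i != j) g i in rest0 offj *.
set u := \sum_(t | _) _ in offj *.
have u0 : 0 <= u.
  by rewrite /u sumr_ge0 // => t _; rewrite mulr_ge0 // ltW.
move=> sle; have sg : s <= g j.
  have : 4 * k%:R * s <= k%:R * (g j + s) by apply: le_trans sle; rewrite ler_wpM2r.
  rewrite -mulrA mulrCA ler_pM2l; last by lra.
  by have := gge0 j; lra.
have K4' : 4 <= K by move: K4 k1; lra.
have w0 : 0 < weight j * h j j by rewrite mulr_gt0.
have : K * u <= 2 * g j * (weight j * h j j).
  by apply: le_trans offj _; rewrite ler_pM2r //; lra.
have : 4 * u <= K * u by rewrite ler_wpM2r.
by rewrite -mulrA; lra.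
Qed.

Lemma kernel_trivial (c : 'I_k -> R) :
  (forall i : 'I_k, \sum_t c t * h t i = 0) -> forall t, c t = 0.
Proof.
move=> c0 j; have := kernel_dominance (j := j) (fun i _ => c0 i).
have hj : 0 < h j j by apply: h_gt0.
have /eqP := c0 j; rewrite (bigD1 j) //= addr_eq0 => /eqP cj.
have : `|c j| * h j j <= \sum_(t < k | t != j) `|c t| * h t j.
  rewrite -[X in _ * X <= _]gtr0_norm // -normrM cj normrN.
  apply: le_trans (ler_norm_sum _ _ _) _; apply: ler_sum => t _.
  by rewrite normrM [`|h _ _|]gtr0_norm // h_gt0.
have : 0 <= `|c j| * h j j by rewrite mulr_ge0 // ltW.
move=> a b e; have : `|c j| * h j j = 0 by lra.
by move/eqP; rewrite mulf_eq0 normr_eq0 (gt_eqF hj) orbF => /eqP.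
Qed.

End Dominance.

(** Two applications of comparability, first at the right end [n] and then
    at the left end [i], bound the total variation by [C * C] times any single
    step; summing over the [n] steps contradicts [C * C < n]. *)
Lemma no_flat_growth (R : realFieldType) (u : nat -> R) (C : R) n :
  1 <= C -> C * C < n%:R ->
  (forall i j, (i < j)%N -> (j <= n)%N -> u i < u j) ->
  (forall i j l, (i < j)%N -> (j < l)%N -> (l <= n)%N ->
     u l - u i <= C * (u j - u i)) ->
  (forall i j l, (i < j)%N -> (j < l)%N -> (l <= n)%N ->
     u l - u i <= C * (u l - u j)) ->
  False.
Proof.
move=> C1 Cn inc left right.
have le_u i j : (i <= j)%N -> (j <= n)%N -> u i <= u j.
  rewrite leq_eqVlt => /orP[/eqP-> //|ij jn]; exact/ltW/inc.
have gap i : (i < n)%N -> u n - u 0%N <= C * C * (u i.+1 - u i).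
  move=> i_n; have s1 : u n - u 0%N <= C * (u n - u i).
    case: i i_n => [|i] i_n; last exact: right.
    by rewrite ler_peMl // subr_ge0 le_u.
  apply: le_trans s1 _; rewrite -mulrA ler_pM2l; last by lra.
  move: i_n; rewrite leq_eqVlt => /orP[/eqP e|i1n]; last exact: left.
  by rewrite -e ler_peMl // subr_ge0 le_u // -e.
have n0 : (0 < n)%N by rewrite -(ltr_nat R); nra.
have D0 : 0 < u n - u 0%N by rewrite subr_gt0 inc.
have : n%:R * (u n - u 0%N) <= C * C * (u n - u 0%N).
  rewrite -{2}(telescope_sumr u (leq0n n)) mulr_sumr mulr_natl.
  rewrite -[X in _ *+ X](subn0 n) -sumr_const_nat.
  by rewrite big_nat_cond [leRHS]big_nat_cond; apply: ler_sum => i /andP[/andP[_ /gap]].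
by rewrite ler_pM2r // leNgt Cn.
Qed.

(** * Interpolation in a separated family *)

(** Index sets are represented by strictly increasing lists, so that an increasing
    list with entries in [X] is automatically a subsequence of [X]. *)
Definition increasing_in (X W : seq nat) := sorted ltn W /\ {subset W <= X}.

Lemma increasing_in_subseq X W V :
  subseq V W -> increasing_in X W -> increasing_in X V.
Proof.
move=> sVW [sW WX]; split; first exact: subseq_sorted ltn_trans _ _ sVW sW.
by move=> x xV; apply/WX/(mem_subseq sVW).
Qed.

Lemma increasing_subseq X W : sorted ltn X -> increasing_in X W -> subseq W X.
Proof.
move=> sX [sW WX]; suff -> : W = [seq x <- X | x \in W] by apply: filter_subseq.
apply: (irr_sorted_eq ltn_trans ltnn) => //; first exact: sorted_filter ltn_trans _ _ sX.
by move=> x; rewrite mem_filter; case: (boolP (x \in W)) => // /WX ->.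
Qed.

Lemma increasing_in_replace X P M S N : increasing_in X (P ++ M ++ S) ->
  sorted ltn N -> {subset N <= M} -> increasing_in X (P ++ N ++ S).
Proof.
move=> inX sN NM.
have sM : sorted ltn M.
  apply: subseq_sorted ltn_trans _ _ _ (proj1 inX).
  by apply: subseq_trans (suffix_subseq P _); apply: prefix_subseq.
apply: increasing_in_subseq inX.
by rewrite cat_subseq // cat_subseq //; apply: increasing_subseq.
Qed.

Section Evaluation.
Variables (R : realFieldType) (d : nat) (A : nat -> 'cV[R]_d).

Definition ev (x : nat) (v : 'rV[R]_d) : R := (v *m A x) 0 0.

Lemma evD x u v : ev x (u + v) = ev x u + ev x v.
Proof. by rewrite /ev mulmxDl mxE. Qed.
Lemma evZ x a v : ev x (a *: v) = a * ev x v.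
Proof. by rewrite /ev -scalemxAl mxE. Qed.
Lemma evB x u v : ev x (u - v) = ev x u - ev x v.
Proof. by rewrite evD -scaleN1r evZ mulN1r. Qed.
Lemma ev_sum x k (v : 'I_k -> 'rV[R]_d) : ev x (\sum_t v t) = \sum_t ev x (v t).
Proof. by rewrite /ev mulmx_suml summxE. Qed.

(** The second condition is growth of the ratios [h t.+1 / h t] with cleared
    denominators.  It is required between any two indices of [X], not only between
    neighbours, so that it passes to sublists. *)
Definition separated (Q : R) (k : nat) (h : nat -> 'rV[R]_d) (X : seq nat) :=
  (forall t x, (t < k)%N -> x \in X -> 0 < ev x (h t)) /\
  (forall t x y, (t.+1 < k)%N -> x \in X -> y \in X -> (x < y)%N ->
     Q * ev x (h t.+1) * ev y (h t) < ev y (h t.+1) * ev x (h t)).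

Section Interpolation.
Variables (k : nat) (K : R) (h : nat -> 'rV[R]_d) (f : 'rV[R]_d) (X : seq nat).
Hypothesis K1 : 1 <= K.
Hypothesis K4 : 4 * k%:R <= K.
Hypothesis h_sep : separated (K * K) k h X.

Definition comb (c : 'I_k -> R) := \sum_t c t *: h t.

Lemma ev_comb x c : ev x (comb c) = \sum_t c t * ev x (h t).
Proof. by rewrite ev_sum; apply: eq_bigr => t _; rewrite evZ. Qed.

Lemma combB a b c e : a *: comb c - b *: comb e = comb (fun t => a * c t - b * e t).
Proof.
rewrite /comb !scaler_sumr -sumrB; apply: eq_bigr => t _.
by rewrite scalerBl !scalerA.
Qed.

Section Nodes.
Variable Z : seq nat.
Hypotheses (ZX : increasing_in X Z) (szZ : size Z = k).

Let nodes_gt0 t i : (t < k)%N -> (i < k)%N -> 0 < ev (nth 0%N Z i) (h t).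
Proof.
by move=> tk ik; apply: (proj1 h_sep) => //; apply/(proj2 ZX)/mem_nth; rewrite szZ.
Qed.

Let nodes_sep t i j : (t.+1 < k)%N -> (i < j)%N -> (j < k)%N ->
  K * K * ev (nth 0%N Z i) (h t.+1) * ev (nth 0%N Z j) (h t) <
    ev (nth 0%N Z j) (h t.+1) * ev (nth 0%N Z i) (h t).
Proof.
move=> tk ij jk; have ik := ltn_trans ij jk; case: ZX => sZ ZinX.
apply: (proj2 h_sep) => //; try by apply/ZinX/mem_nth; rewrite szZ.
by apply: (sorted_ltn_nth ltn_trans); rewrite ?inE ?szZ.
Qed.

(** A combination that vanishes at all nodes except the [j]-th one is, at that
    node, essentially its [j]-th term.  Moving the [j]-th node while keeping the
    others shows that on the whole gap between its neighbours the combination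
    behaves like a multiple of [h j]. *)
Lemma comb_dominance (c : 'I_k -> R) (j : 'I_k) :
  (forall i, (i < k)%N -> i != j -> ev (nth 0%N Z i) (comb c) = 0) ->
  2 * `|ev (nth 0%N Z j) (comb c) - c j * ev (nth 0%N Z j) (h j)|
    <= `|c j| * ev (nth 0%N Z j) (h j).
Proof.
move=> c0; have c0' (i : 'I_k) : i != j -> \sum_t c t * ev (nth 0%N Z i) (h t) = 0.
  by move=> ij; rewrite -ev_comb c0.
apply: le_trans (kernel_dominance K1 K4 nodes_gt0 nodes_sep c0').
rewrite ler_pM2l // ev_comb (bigD1 j) //= addrAC subrr add0r.
apply: le_trans (ler_norm_sum _ _ _) _; apply: ler_sum => t _.
by rewrite normrM [X in _ * X]gtr0_norm // nodes_gt0.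
Qed.

Lemma comb_eq0 (c : 'I_k -> R) :
  (forall z, z \in Z -> ev z (comb c) = 0) -> comb c = 0.
Proof.
move=> c0; rewrite /comb big1 // => t _.
rewrite (kernel_trivial K1 K4 nodes_gt0 nodes_sep) ?scale0r // => i.
by rewrite -ev_comb c0 // mem_nth ?szZ.
Qed.

Definition nodes_mx (V : seq nat) : 'M[R]_k := \matrix_(t, i) ev (nth 0%N V i) (h t).

Lemma nodes_mx_unit : nodes_mx Z \in unitmx.
Proof.
rewrite unitmxE unitfE; apply/negP => /det0P[c c_neq0 /rowP c0]; case/negP: c_neq0.
apply/eqP/rowP => t; rewrite mxE.
apply: (kernel_trivial K1 K4 nodes_gt0 nodes_sep (c := fun t => c 0 t)) => i.
have := c0 i; rewrite !mxE; apply: etrans.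
by apply: eq_bigr => s _; rewrite [nodes_mx _ _ _]mxE.
Qed.

End Nodes.

(** The element of [f + span h] with roots [Z]; its coefficients solve the linear
    system with matrix [nodes_mx Z], invertible by [kernel_trivial]. *)
Definition interp (Z : seq nat) : 'rV[R]_d :=
  f - comb (((\row_i ev (nth 0%N Z i) f) *m invmx (nodes_mx Z)) 0).

Lemma interp_root Z z : increasing_in X Z -> size Z = k -> z \in Z ->
  ev z (interp Z) = 0.
Proof.
move=> ZX szZ /(nthP 0%N)[i]; rewrite szZ => ik <-.
rewrite evB ev_comb; apply/eqP; rewrite subr_eq0 eq_sym; apply/eqP.
transitivity ((\row_i ev (nth 0%N Z i) f *m invmx (nodes_mx Z) *m nodes_mx Z) 0 (Ordinal ik)).
  by rewrite [RHS]mxE; apply: eq_bigr => t _; rewrite [nodes_mx _ _ _]mxE.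
by rewrite mulmxKV ?nodes_mx_unit // mxE.
Qed.

Lemma interpB Z V : exists c, interp Z - interp V = comb c.
Proof.
rewrite /interp opprB addrC addrA subrK.
set c := (_ *m _) 0; set e := (_ *m _) 0; exists (fun t => 1 * c t - 1 * e t).
by rewrite -combB !scale1r.
Qed.

(** The heart of the proof: with [j] fixed roots [P] on the left and the other
    fixed roots [S] on the right, an additional root [y] in the long list [M]
    cannot produce forms that neither outgrow [h j] to the right of [y] nor are
    outgrown by [h j] to the left of [y].  Both kinds of growth are read off from
    one function [rho], since [interp (P ++ y :: S)] at [x] is
    [(rho x - rho y) * H x] with [H] close to [a * h j]. *)
Lemma no_flat_middle n (j : nat) (P M S : seq nat) (s : R) :
  (j < k)%N -> size P = j -> size S = (k - j.+1)%N ->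
  increasing_in X (P ++ M ++ S) -> size M = n.+1 ->
  (3 * (K * K)) * (3 * (K * K)) < n%:R -> `|s| = 1 ->
  (forall y x, y \in M -> x \in M -> (y < x)%N ->
     0 < s * ev x (interp (P ++ y :: S))) ->
  (forall y x1 x2, y \in M -> x1 \in M -> x2 \in M -> (y < x1 < x2)%N ->
     `|ev x2 (interp (P ++ y :: S))| * ev x1 (h j) <=
       K * K * `|ev x1 (interp (P ++ y :: S))| * ev x2 (h j)) ->
  (forall x1 x2 y, x1 \in M -> x2 \in M -> y \in M -> (x1 < x2 < y)%N ->
     `|ev x1 (interp (P ++ y :: S))| * ev x2 (h j) <=
       K * K * ev x1 (h j) * `|ev x2 (interp (P ++ y :: S))|) ->
  False.
Proof.
move=> jk szP szS inX szM Cn s1 sgn flatG flatS.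
have KK1 : 1 <= K * K by rewrite (le_trans K1) // ler_peMl // (le_trans ler01).
have n0 : (0 < n)%N by rewrite -(ltr_nat R); nra.
have mM i : (i <= n)%N -> nth 0%N M i \in M by move=> i_n; rewrite mem_nth ?szM.
have sM : sorted ltn M.
  apply: subseq_sorted ltn_trans _ _ _ (proj1 inX).
  by apply: subseq_trans (suffix_subseq P _); apply: prefix_subseq.
have m_lt i l : (i < l)%N -> (l <= n)%N -> (nth 0 M i < nth 0 M l)%N.
  move=> il ln; apply: (sorted_ltn_nth ltn_trans) => //; rewrite inE szM //.
  by rewrite ltnS ltnW // (leq_trans il).
have MX x : x \in M -> x \in X.
  by move=> xM; apply: (proj2 inX); rewrite !mem_cat xM orbT.
have adm x : x \in M -> increasing_in X (P ++ x :: S).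
  move=> xM; apply: (@increasing_in_replace _ _ M _ [:: x]) => //.
  by move=> y; rewrite inE => /eqP->.
have szZ (x : nat) : size (P ++ x :: S) = k by rewrite size_cat /= szP szS; lia.
pose m i := nth 0%N M i; pose g i := interp (P ++ m i :: S).
have g_root i z : (i <= n)%N -> z \in P ++ m i :: S -> ev z (g i) = 0.
  by move=> i_n zZ; apply: interp_root => //; apply/adm/mM.
have g_rootPS i z : (i <= n)%N -> z \in P ++ S -> ev z (g i) = 0.
  move=> i_n zZ; apply: g_root => //; move: zZ; rewrite !mem_cat inE.
  by case/orP=> ->; rewrite ?orbT.
have [e He] := interpB (P ++ m 0%N :: S) (P ++ m 1%N :: S).
(* Up to a factor, the only combination of the h t with roots P ++ S. *)
pose H := g 0%N - g 1%N; have {}He : H = comb e := He.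
have H_root z : z \in P ++ S -> ev z H = 0.
  by move=> zPS; rewrite evB !g_rootPS // subrr.
pose a := e (Ordinal jk).
have hj i : (i <= n)%N -> 0 < ev (m i) (h j).
  by move=> i_n; apply: (proj1 h_sep) => //; apply/MX/mM.
have dom i : (i <= n)%N ->
    2 * `|ev (m i) H - a * ev (m i) (h j)| <= `|a| * ev (m i) (h j).
  move=> i_n; have nthj : nth 0%N (P ++ m i :: S) j = m i.
    by rewrite nth_cat szP ltnn subnn.
  have := @comb_dominance _ (adm _ (mM _ i_n)) (szZ _) e (Ordinal jk).
  rewrite /= nthj -He; apply=> l lk lj; apply: H_root.
  rewrite nth_cat mem_cat szP; case: ltnP => [lltj | jl].
    by rewrite mem_nth ?szP.
  have -> : (l - j = (l - j.+1).+1)%N by move: lj; lia.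
  by rewrite /= mem_nth ?orbT // szS; move: lj; lia.
(* Otherwise H, hence g 0, would vanish at m 1, against the sign condition. *)
have a0 : a != 0.
  apply/eqP => a0; have := dom 1%N n0; rewrite a0 normr0 !mul0r subr0.
  have : 0 < s * ev (m 1%N) (g 0%N) by apply: sgn; rewrite ?mM // m_lt.
  have -> : ev (m 1%N) H = ev (m 1%N) (g 0%N).
    by rewrite evB (g_root 1%N) ?subr0 // mem_cat inE eqxx orbT.
  move=> pos.
  by rewrite pmulr_rle0 // normr_le0 => /eqP z; rewrite z mulr0 ltxx in pos.
have [r rE] : exists r : nat -> R,
    forall i, (i <= n)%N -> ev (m i) H = r i * a * ev (m i) (h j).
  exists (fun i => ev (m i) H / (a * ev (m i) (h j))) => i.
  by move=> i_n; rewrite -mulrA divfK // mulf_neq0 // gt_eqF // hj.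
have r_bound i : (i <= n)%N -> 1 <= 2 * r i <= 3.
  move=> i_n; have := dom i i_n; rewrite rE // -mulrA -{2}[a * _]mul1r -mulrBl.
  rewrite normrM mulrA [`|a * _|]normrM [`|ev _ _|]gtr0_norm ?hj //.
  rewrite ger_pMl ?mulr_gt0 ?normr_gt0 ?hj // => b.
  by have := ler_norm (r i - 1); have := lerNnormlW (lexx `|r i - 1|); lra.
have H0 i : (i <= n)%N -> ev (m i) H != 0.
  move=> i_n; have r_gt0 : 0 < r i by have := r_bound i i_n; lra.
  by rewrite rE // mulf_neq0 ?(mulf_neq0 (lt0r_neq0 r_gt0)) // gt_eqF ?hj.
pose rho i := ev (m i) (g 0%N) / ev (m i) H.
(* g l and g 0 - rho l * H differ by an element of the span that vanishes on the
   k points P ++ m l :: S. *)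
have rhoE i l : (i <= n)%N -> (l <= n)%N ->
    ev (m i) (g l) = (rho i - rho l) * ev (m i) H.
  move=> i_n l_n; have [c gc] := interpB (P ++ m l :: S) (P ++ m 0%N :: S).
  have {}gc : g l - g 0%N = comb c := gc.
  have cb0 : 1 *: comb c - (- rho l) *: comb e = 0.
    rewrite combB; apply: (comb_eq0 (adm _ (mM _ l_n)) (szZ _)) => z zZ.
    rewrite -combB scale1r -gc -He scaleNr opprK evD evZ evB.
    rewrite g_root //; have [/eqP-> | zm] := boolP (z == m l).
      by rewrite /rho divfK ?H0 // sub0r addNr.
    have zPS : z \in P ++ S by move: zZ; rewrite !mem_cat inE (negPf zm).
    by rewrite g_rootPS // H_root // mulr0 subr0 addr0.
  have /eqP := congr1 (ev (m i)) cb0.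
  rewrite scale1r -gc -He scaleNr opprK evD evZ evB [ev _ 0]/ev mul0mx mxE.
  rewrite mulrBl [rho i]/rho divfK ?H0 // => /eqP; lra.
clearbody rho; pose theta i := s * a * rho i.
have absE i l : (i <= n)%N -> (l <= n)%N ->
    `|ev (m i) (g l)| = `|theta i - theta l| * r i * ev (m i) (h j).
  move=> i_n l_n; rewrite rhoE // rE // /theta -mulrBr !normrM s1 mul1r.
  rewrite [`|ev _ _|]gtr0_norm ?hj // [`|r i|]gtr0_norm; first by ring.
  by have := r_bound i i_n; lra.
have inc i l : (i < l)%N -> (l <= n)%N -> theta i < theta l.
  move=> il l_n; have i_n : (i <= n)%N by rewrite ltnW // (leq_trans il).
  have : 0 < s * ev (m l) (g i) by apply: sgn; rewrite ?mM // m_lt.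
  rewrite rhoE // rE // => pos; rewrite -subr_gt0 /theta -mulrBr; move: pos.
  rewrite [X in 0 < X](_ : _ = s * a * (rho l - rho i) * (r l * ev (m l) (h j))); last by ring.
  by rewrite pmulr_lgt0 // mulr_gt0 ?hj //; have := r_bound l l_n; lra.
apply: (@no_flat_growth _ theta (3 * (K * K)) n) => //.
- by lra.
- move=> l i1 i2 li ii i2n; have i1n : (i1 <= n)%N by rewrite ltnW // (leq_trans ii).
  have l_n : (l <= n)%N by rewrite ltnW // (leq_trans li).
  have := flatG (m l) (m i1) (m i2); rewrite !mM // !m_lt // => /(_ isT isT isT isT).
  rewrite !absE // ![`|theta _ - _|]gtr0_norm ?subr_gt0 ?inc // ?(ltn_trans li) //.
  rewrite [X in X <= _](_ : _ = (theta i2 - theta l) * r i2 * (ev (m i1) (h j) * ev (m i2) (h j))); last by ring.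
  rewrite [X in _ <= X](_ : _ = K * K * (theta i1 - theta l) * r i1 * (ev (m i1) (h j) * ev (m i2) (h j))); last by ring.
  rewrite ler_pM2r ?mulr_gt0 ?hj // => le1.
  have /andP[b1 b2] := r_bound i1 i1n; have /andP[b3 b4] := r_bound i2 i2n.
  have d1 : 0 < K * K * (theta i1 - theta l) by rewrite mulr_gt0 ?subr_gt0 ?inc //; lra.
  have d2 : 0 < theta i2 - theta l by rewrite subr_gt0 inc // (ltn_trans li).
  rewrite -mulrA; set D := K * K * _ in le1 d1 *; nra.
- move=> i1 i2 l ii il l_n; have i2n : (i2 <= n)%N by rewrite ltnW // (leq_trans il).
  have i1n : (i1 <= n)%N by rewrite ltnW // (leq_trans ii).
  have := flatS (m i1) (m i2) (m l); rewrite !mM // !m_lt // => /(_ isT isT isT isT).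
  rewrite !absE // ![`|theta _ - _|]ltr0_norm ?subr_lt0 ?inc // ?(ltn_trans ii) // !opprB.
  rewrite [X in X <= _](_ : _ = (theta l - theta i1) * r i1 * (ev (m i1) (h j) * ev (m i2) (h j))); last by ring.
  rewrite [X in _ <= X](_ : _ = K * K * (theta l - theta i2) * r i2 * (ev (m i1) (h j) * ev (m i2) (h j))); last by ring.
  rewrite ler_pM2r ?mulr_gt0 ?hj // => le1.
  have /andP[b1 b2] := r_bound i1 i1n; have /andP[b3 b4] := r_bound i2 i2n.
  have d1 : 0 < K * K * (theta l - theta i2) by rewrite mulr_gt0 ?subr_gt0 ?inc //; lra.
  have d2 : 0 < theta l - theta i1 by rewrite subr_gt0 inc // (ltn_trans ii).
  rewrite -mulrA; set D := K * K * _ in le1 d1 *; nra.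
Qed.

End Interpolation.
End Evaluation.

(** * Inserting one more linear form *)

Definition insert_at (T : Type) (m : nat) (g : T) (h : nat -> T) (t : nat) : T :=
  if (t < m)%N then h t else if t == m then g else h t.-1.

Lemma increasing_in_trans X Y W :
  {subset Y <= X} -> increasing_in Y W -> increasing_in X W.
Proof. by move=> YX [sW WY]; split=> // x /WY /YX. Qed.

Lemma split_middle (X : seq nat) (j l L : nat) : size X = (j + L + l)%N ->
  exists P M S, [/\ X = P ++ M ++ S, size P = j, size M = L & size S = l].
Proof.
move=> szX; exists (take j X), (take L (drop j X)), (drop L (drop j X)).
by rewrite !cat_take_drop !size_drop !size_takel ?size_drop //; try lia; split=> //; lia.
Qed.

Section Insertion.
Variables (R : realFieldType) (d : nat) (A : nat -> 'cV[R]_d).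
Local Notation ev := (ev A).
Local Notation separated := (separated A).

(** General position in the form in which it is used: a nonzero linear form does
    not vanish at [d] indices. *)
Definition generic (X : seq nat) := forall (v : 'rV[R]_d) (Y : seq nat),
  increasing_in X Y -> size Y = d -> (forall y, y \in Y -> ev y v = 0) -> v = 0.

Lemma generic_sub X Y : {subset Y <= X} -> generic X -> generic Y.
Proof. by move=> YX gX v W WY; apply: gX; apply: increasing_in_trans WY. Qed.

Lemma separated_sub Q k h X Y :
  {subset Y <= X} -> separated Q k h X -> separated Q k h Y.
Proof.
move=> YX [pos sep]; split=> [t x tk /YX|t x y tk /YX xX /YX yX]; first exact: pos.
exact: sep.
Qed.

Variables (k : nat) (K : R) (h : nat -> 'rV[R]_d) (f : 'rV[R]_d).
Local Notation interp := (interp A k h f).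

Definition grows (m : nat) (g : 'rV[R]_d) (x y : nat) : bool :=
  K * K * `|ev x g| * ev y (h m) < `|ev y g| * ev x (h m).
Definition decays (m : nat) (g : 'rV[R]_d) (x y : nat) : bool :=
  K * K * ev x (h m) * `|ev y g| < ev y (h m) * `|ev x g|.

(** In both predicates [P] and [S] are the left and right roots of pattern [m], and
    the tested indices lie between them. *)
Definition uniform_sign (X : seq nat) (m : nat) (s : R) :=
  forall P x S, size P = m -> size S = (k - m)%N ->
    increasing_in X (P ++ x :: S) -> 0 < s * ev x (interp (P ++ S)).

Definition uniform_growth (X : seq nat) (m : nat) (G D : bool) :=
  forall P x y S, size P = m -> size S = (k - m)%N ->
    increasing_in X (P ++ x :: y :: S) ->
    grows m.-1 (interp (P ++ S)) x y = G /\ decays m (interp (P ++ S)) x y = D.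

(** Only the ratios of [g] with its two new neighbours need to be checked. *)
Lemma separated_insert X m (g : 'rV[R]_d) : (m <= k)%N ->
  separated (K * K) k h X -> (forall x, x \in X -> 0 < ev x g) ->
  (forall x y, x \in X -> y \in X -> (x < y)%N -> (0 < m)%N -> grows m.-1 g x y) ->
  (forall x y, x \in X -> y \in X -> (x < y)%N -> (m < k)%N -> decays m g x y) ->
  separated (K * K) k.+1 (insert_at m g h) X.
Proof.
move=> mk [pos sep] g0 inc dec; rewrite /insert_at; split=> [t x tk xX | t x y tk xX yX xy].
  by case: ltngtP => tm; [apply: pos => //; lia | apply: pos => //; lia | apply: g0].
have [t1m|mt1|mt1] := ltngtP t.+1 m.
- by apply: sep => //; lia.
- case: eqP => [->|tm].
    have mk' : (m < k)%N by lia.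
    have := dec x y xX yX xy mk'.
    by rewrite /decays !gtr0_norm ?g0.
  by case: t tk mt1 tm => [|t] tk mt1 tm; [lia | apply: sep => //; lia].
- have m0 : (0 < m)%N by rewrite -mt1.
  have := inc x y xX yX xy m0.
  by rewrite /grows -mt1 !gtr0_norm ?g0.
Qed.

(** The colorings for Ramsey's theorem.  A word of size [k+1] (resp. [k+2]) is
    read in all patterns at once: for each [m], its entry [m] (resp. entries [m]
    and [m+1]) is tested, and the [k] other entries are the roots. *)
Definition sign_color (w : seq nat) : {ffun 'I_k.+1 -> bool * bool} :=
  [ffun m : 'I_k.+1 => let v := ev (nth 0%N w m) (interp (take m w ++ drop m.+1 w)) in
     (0 < v, v < 0)].

Definition growth_color (w : seq nat) : {ffun 'I_k.+1 -> bool * bool} :=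
  [ffun m : 'I_k.+1 => let g := interp (take m w ++ drop m.+2 w) in
     let x := nth 0%N w m in let y := nth 0%N w m.+1 in
     (grows m.-1 g x y, decays m g x y)].

(** The sign cannot be uniformly zero: the form would then vanish at [d] indices
    between its roots. *)
Lemma uniform_sign_homogeneous X c m : sorted ltn X -> generic X ->
  (k + d <= size X)%N -> (forall c : 'I_k -> R, f - comb h c != 0) ->
  homogeneous k.+1 sign_color c X -> (m <= k)%N ->
  exists2 s, `|s| = 1 & uniform_sign X m s.
Proof.
move=> sX gX szX f_indep hX mk.
have colorE P x S : size P = m -> size S = (k - m)%N -> increasing_in X (P ++ x :: S) ->
    (0 < ev x (interp (P ++ S)), ev x (interp (P ++ S)) < 0) = c (inord m).
  move=> szP szS PS; have := hX _ (increasing_subseq sX PS).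
  have -> : size (P ++ x :: S) = k.+1 by rewrite size_cat /= szP szS; lia.
  move=> /(_ erefl)/ffunP/(_ (inord m)); rewrite ffunE inordK // => <-.
  by rewrite -szP take_size_cat // nth_cat ltnn subnn -cat_rcons drop_size_cat ?size_rcons.
case defc : (c (inord m)) => [[] neg].
  exists 1; first by rewrite normr1.
  by move=> P x S szP szS PS; have := colorE P x S szP szS PS; rewrite defc mul1r => -[].
case: neg defc => defc.
  exists (-1); first by rewrite normrN1.
  move=> P x S szP szS PS; have := colorE P x S szP szS PS.
  by rewrite defc mulN1r oppr_gt0 => -[].
have [|P [M [S [defX szP szM szS]]]] := @split_middle X m (size X - d - m) d.
  by lia.
pose S' := drop (size S - (k - m)) S.
have szS' : size S' = (k - m)%N by rewrite size_drop szS; lia.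
have inX : increasing_in X (P ++ M ++ S').
  apply: (@increasing_in_subseq _ X); last by split.
  by rewrite [X in subseq _ X]defX !cat_subseq // drop_subseq.
have /eqP[] := f_indep (((\row_i ev (nth 0%N (P ++ S') i) f) *m
  invmx (nodes_mx A k h (P ++ S'))) 0).
apply: (gX _ M) => //.
  apply: increasing_in_subseq inX.
  by apply: subseq_trans (suffix_subseq P _); apply: prefix_subseq.
move=> x xM; apply/eqP; rewrite eq_le !leNgt.
have PxS : increasing_in X (P ++ x :: S').
  by apply: (@increasing_in_replace _ _ M _ [:: x]) => // y; rewrite inE => /eqP->.
by have := colorE P x S' szP szS' PxS; rewrite defc => -[-> ->].
Qed.

Lemma uniform_growth_homogeneous X c m : sorted ltn X ->
  homogeneous k.+2 growth_color c X -> (m <= k)%N ->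
  uniform_growth X m (c (inord m)).1 (c (inord m)).2.
Proof.
move=> sX hX mk P x y S szP szS PS; have := hX _ (increasing_subseq sX PS).
have -> : size (P ++ x :: y :: S) = k.+2 by rewrite size_cat /= szP szS; lia.
move=> /(_ erefl)/ffunP/(_ (inord m)); rewrite ffunE inordK // => <-.
rewrite -szP take_size_cat // !nth_cat ltnn subnn ltnNge leqnSn /= subSnn /=.
by rewrite -cat_rcons -cat_rcons drop_size_cat ?size_rcons.
Qed.

Hypothesis K1 : 1 <= K.
Hypothesis K4 : 4 * k%:R <= K.

(** Pattern [j.+1] with rightmost left root [y], and pattern [j] with leftmost right
    root [y], both have the root set [P ++ y :: S] of [no_flat_middle]. *)
Lemma growth_or_decay X L (s : nat -> R) (G D : nat -> bool) j :
  separated (K * K) k h X -> sorted ltn X -> size X = (k + L)%N ->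
  (3 * (K * K)) * (3 * (K * K)) < L%:R ->
  (forall m, (m <= k)%N -> `|s m| = 1) ->
  (forall m, (m <= k)%N -> uniform_sign X m (s m)) ->
  (forall m, (m <= k)%N -> uniform_growth X m (G m) (D m)) ->
  (j < k)%N -> G j.+1 || D j.
Proof.
move=> h_sep sX szX bigL s1 sgn gd jk; apply/negPn; apply/negP => /norP[nG nD].
have [|P [M [S [defX szP szM szS]]]] := @split_middle X j (k - j.+1) L.+1.
  by rewrite szX; lia.
have inX : increasing_in X (P ++ M ++ S) by rewrite -defX; split.
have rep N : sorted ltn N -> {subset N <= M} -> increasing_in X (P ++ N ++ S).
  by move=> sN NM; apply: increasing_in_replace sN NM.
apply: (no_flat_middle K1 K4 h_sep jk szP szS inX szM bigL (s1 j.+1 jk)).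
- move=> y x yM xM yx; rewrite -cat_rcons; apply: sgn => //.
  + by rewrite size_rcons szP.
  + rewrite cat_rcons; apply: (rep [:: y; x]); first by rewrite /= yx.
    by move=> z; rewrite !inE => /orP[] /eqP->.
- move=> y x1 x2 yM x1M x2M /andP[yx1 x12]; rewrite leNgt; apply: contra nG.
  rewrite -cat_rcons; have [] := gd j.+1 jk (rcons P y) x1 x2 S _ szS _; last first.
  + by move=> <- _.
  + rewrite cat_rcons; apply: (rep [:: y; x1; x2]); first by rewrite /= yx1 x12.
    by move=> z; rewrite !inE => /or3P[] /eqP->.
  + by rewrite size_rcons szP.
- move=> x1 x2 y x1M x2M yM /andP[x12 x2y]; rewrite leNgt; apply: contra nD.
  have [] := gd j (ltnW jk) P x1 x2 (y :: S) szP _ _; last first.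
  + by move=> _ <-; rewrite /decays [X in _ < X]mulrC.
  + apply: (rep [:: x1; x2; y]); first by rewrite /= x12 x2y.
    by move=> z; rewrite !inE => /or3P[] /eqP->.
  + by rewrite /= szS; lia.
Qed.

(** The rank [m] of the new form is the first one at which the form is outgrown
    by [h m]; minimality and [growth_or_decay] make it outgrow [h m.-1]. *)
Lemma insert_uniform X L (s : nat -> R) (G D : nat -> bool) :
  separated (K * K) k h X -> sorted ltn X -> size X = (k + L)%N ->
  (3 * (K * K)) * (3 * (K * K)) < L%:R ->
  (forall m, (m <= k)%N -> `|s m| = 1) ->
  (forall m, (m <= k)%N -> uniform_sign X m (s m)) ->
  (forall m, (m <= k)%N -> uniform_growth X m (G m) (D m)) ->
  exists m r (c : 'I_k -> R) Y, [/\ (m <= k)%N, r != 0, increasing_in X Y, size Y = L &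
    separated (K * K) k.+1 (insert_at m (r *: (f - comb h c)) h) Y].
Proof.
move=> h_sep sX szX bigL s1 sgn gd.
have ex_m : exists m, (m == k) || D m by exists k; rewrite eqxx.
have [m Dm m_min] := ex_minnP ex_m; have mk : (m <= k)%N by apply: m_min; rewrite eqxx.
have Gm : (0 < m)%N -> G m.
  case: m {Dm} m_min mk => // m m_min mk _.
  have /orP[//|Dm] := growth_or_decay h_sep sX szX bigL s1 sgn gd mk.
  by have := m_min m; rewrite Dm orbT ltnn => /(_ isT).
have {}Dm : (m < k)%N -> D m by move: Dm; case: ltngtP.
have [|P [Y [S [defX szP szY szS]]]] := @split_middle X m (k - m) L.
  by rewrite szX; lia.
have inX : increasing_in X (P ++ Y ++ S) by rewrite -defX; split.
have rep N : sorted ltn N -> {subset N <= Y} -> increasing_in X (P ++ N ++ S).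
  by move=> sN NY; apply: increasing_in_replace sN NY.
have YX : increasing_in X Y.
  apply: increasing_in_subseq inX.
  by apply: subseq_trans (suffix_subseq P _); apply: prefix_subseq.
have [c defg] : exists c : 'I_k -> R, interp (P ++ S) = f - comb h c by eexists.
have sm1 := s1 m mk; have sm0 : s m != 0 by rewrite -normr_eq0 sm1 oner_eq0.
exists m, (s m), c, Y; rewrite -defg; split=> //.
set g := interp _.
have abs_sg x : `|ev x (s m *: g)| = `|ev x g| by rewrite evZ normrM sm1 mul1r.
have pair x y : x \in Y -> y \in Y -> (x < y)%N ->
    increasing_in X (P ++ x :: y :: S).
  move=> xY yY xy; apply: (rep [:: x; y]); first by rewrite /= xy.
  by move=> z; rewrite !inE => /orP[] /eqP->.
apply: separated_insert => //; first exact: separated_sub (proj2 YX) h_sep.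
- move=> x xY; rewrite evZ; apply: sgn => //; apply: (rep [:: x]) => //.
  by move=> z; rewrite inE => /eqP->.
- move=> x y xY yY xy /Gm; rewrite /grows !abs_sg.
  by have [] := gd m mk P x y S szP szS (pair _ _ xY yY xy); rewrite /grows => -> _.
- move=> x y xY yY xy /Dm; rewrite /decays !abs_sg.
  by have [] := gd m mk P x y S szP szS (pair _ _ xY yY xy); rewrite /decays => _ ->.
Qed.

End Insertion.

Lemma insertion (R : realType) (d k : nat) (K : R) (L : nat) :
  1 <= K -> 4 * k%:R <= K ->
  exists N, forall (A : nat -> 'cV[R]_d) (h : nat -> 'rV[R]_d) (f : 'rV[R]_d) X,
    sorted ltn X -> (N <= size X)%N -> generic A X -> separated A (K * K) k h X ->
    (forall c : 'I_k -> R, f - comb h c != 0) ->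
  exists m r (c : 'I_k -> R) Y, [/\ (m <= k)%N, r != 0, increasing_in X Y,
    (L <= size Y)%N &
    separated A (K * K) k.+1 (insert_at m (r *: (f - comb h c)) h) Y].
Proof.
move=> K1 K4; pose B : R := (3 * (K * K)) * (3 * (K * K)).
(* B is the square of 3 * (K * K), where 3 is the distortion between the form H
   of no_flat_middle and a multiple of h j. *)
pose L' := maxn L (Num.bound B).
have bigL : B < L'%:R.
  apply: lt_le_trans (_ : (Num.bound B)%:R <= _); last by rewrite ler_nat; lia.
  by apply: archi_boundP; rewrite !mulr_ge0 //; lra.
have [N2 hN2] := ramsey nat ({ffun 'I_k.+1 -> bool * bool} : finType) k.+2 (k + L').
have [N1 hN1] := ramsey nat ({ffun 'I_k.+1 -> bool * bool} : finType) k.+1 (maxn N2 (k + d)).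
exists N1 => A h f X sX szX gX h_sep f_indep.
have [c1 [X1 [sX1 szX1 hX1]]] := hN1 (sign_color A k h f) X szX.
have [|c2 [X2 [sX2 szX2 hX2]]] := hN2 (growth_color A k K h f) X1; first by lia.
have X1X := mem_subseq sX1; have X2X1 := mem_subseq sX2.
have srt1 := subseq_sorted ltn_trans sX1 sX.
have srt2 := subseq_sorted ltn_trans sX2 srt1.
have sep1 := separated_sub X1X h_sep; have sep2 := separated_sub X2X1 sep1.
have sgn m : exists s, (m <= k)%N -> `|s| = 1 /\ uniform_sign A k h f X2 m s.
  case: leqP => mk; last by exists 0.
  have [|s s1 us] := uniform_sign_homogeneous srt1 (generic_sub X1X gX) _ f_indep hX1 mk.
    by rewrite szX1; lia.
  exists s => _; split=> // P x S szP szS PS.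
  by apply: us => //; apply: increasing_in_trans X2X1 PS.
have [s hs] := boolp.choice sgn.
have [m [r [c [Y [mk r0 YX szY sepY]]]]] := insert_uniform K1 K4 sep2 srt2 szX2 bigL
  (fun m mk => (hs m mk).1) (fun m mk => (hs m mk).2)
  (fun m mk => uniform_growth_homogeneous srt2 hX2 mk).
exists m, r, c, Y; split=> //; last by rewrite szY; lia.
by apply: increasing_in_trans YX => x /X2X1/X1X.
Qed.


(** * Triangular bases and the theorem *)

Definition last_nonzero_at (R : realFieldType) (d : nat) (v : 'rV[R]_d) (s : nat) :=
  forall j : 'I_d, (j = s :> nat -> v 0 j != 0) /\ ((s < j)%N -> v 0 j = 0).

(** The rank [t] of a form and the index [sigma t] of its last nonzero coordinate
    are unrelated: [f] may be inserted at any rank.  Sorting the forms by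
    [sigma] instead of by rank gives a triangular matrix. *)
Lemma separated_basis (R : realType) (d k : nat) (K : R) (L : nat) :
  1 <= K -> 4 * d%:R <= K -> (k <= d)%N ->
  exists N, forall (A : nat -> 'cV[R]_d) X,
    sorted ltn X -> (N <= size X)%N -> generic A X ->
  exists h sigma Y, [/\ increasing_in X Y, (L <= size Y)%N, separated A (K * K) k h Y,
    forall t, (t < k)%N -> (sigma t < k)%N /\ last_nonzero_at (h t) (sigma t) &
    forall t u, (t < k)%N -> (u < k)%N -> sigma t = sigma u -> t = u].
Proof.
move=> K1 K4; elim: k L => [|k IH] L kd.
  by exists L => A X sX szX _; exists (fun _ => 0), id, X; split=> //; split.
have K4' : 4 * k%:R <= K by apply: le_trans K4; rewrite ler_pM2l // ler_nat ltnW.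
have [N1 hN1] := insertion d L K1 K4'.
have [N hN] := IH N1 (ltnW kd); exists N => A X sX szX gX.
have [h [sigma [Y [YX szY sepY ldg inj]]]] := hN A X sX szX gX.
(* The older forms live in the first k coordinates; f is the next coordinate. *)
pose f : 'rV[R]_d := delta_mx 0 (Ordinal kd).
have comb0 (c : 'I_k -> R) (j : 'I_d) : (k <= j)%N -> (comb h c) 0 j = 0.
  move=> kj; rewrite summxE big1 // => t _; rewrite mxE.
  have [tk /(_ j)[_ ->]] := ldg t (ltn_ord t); first by rewrite mulr0.
  exact: leq_trans kj.
have f_indep (c : 'I_k -> R) : f - comb h c != 0.
  apply/eqP => /rowP/(_ (Ordinal kd)); rewrite !mxE comb0 //.
  by rewrite !eqxx subr0 => /eqP; rewrite oner_eq0.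
have [m [r [c [Z [mk r0 ZY szZ sepZ]]]]] :=
  hN1 A h f Y (proj1 YX) szY (generic_sub (proj2 YX) gX) sepY f_indep.
exists (insert_at m (r *: (f - comb h c)) h), (insert_at m k sigma), Z; split=> //.
- exact: increasing_in_trans (proj2 YX) ZY.
- move=> t tk; rewrite /insert_at.
  have old u : (u < k)%N -> (sigma u < k.+1)%N /\ last_nonzero_at (h u) (sigma u).
    by move=> /ldg[uk l]; split=> //; apply: ltnW.
  case: (ltngtP t m) => /= tm; [by apply: old; lia | by apply: old; lia | split=> // j].
  have -> : (r *: (f - comb h c)) 0 j = r * ((j == k :> nat)%:R - comb h c 0 j).
    by rewrite !mxE -val_eqE.
  split=> [jk | kj]; first by rewrite comb0 jk // eqxx subr0 mulr1.
  by rewrite (comb0 _ _ (ltnW kj)) (gtn_eqF kj) subr0 mulr0.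
- move=> t u tk uk; rewrite /insert_at.
  have ltk v : (v < k)%N -> sigma v <> k by move=> /ldg[+ _] e; rewrite e ltnn.
  case: (ltngtP t m) => tm; case: (ltngtP u m) => um e;
    try (by have := inj _ _ _ _ e; lia); try (by case: (ltk _ _ e); lia);
    try (by case: (ltk _ _ (esym e)); lia); lia.
Qed.

(** Ratios of forms of non-consecutive ranks are products of consecutive ratios. *)
Lemma separated_rank (R : realFieldType) (d : nat) (A : nat -> 'cV[R]_d) Q k h X s t x y :
  1 <= Q -> separated A Q k h X -> (s < t)%N -> (t < k)%N ->
  x \in X -> y \in X -> (x < y)%N ->
  Q * (ev A x (h t) / ev A x (h s)) < ev A y (h t) / ev A y (h s).
Proof.
move=> Q1 [pos sep] st tk xX yX xy.
have step u : (u.+1 < k)%N ->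
    Q * (ev A x (h u.+1) / ev A x (h u)) < ev A y (h u.+1) / ev A y (h u).
  move=> uk; have uk' := ltnW uk.
  rewrite ltr_pdivlMr ?pos // mulrA mulrAC ltr_pdivrMr ?pos //; exact: sep.
have ratio_gt0 u v z : (u < k)%N -> (v < k)%N -> z \in X ->
    0 < ev A z (h u) / ev A z (h v) by move=> *; rewrite divr_gt0 ?pos.
elim: t st tk => // t IH; rewrite ltnS leq_eqVlt => /orP[/eqP-> | st] tk; first exact: step.
have tk' := ltnW tk; have sk := ltn_trans st tk'.
have splitE z : z \in X -> ev A z (h t.+1) / ev A z (h s) =
    ev A z (h t.+1) / ev A z (h t) * (ev A z (h t) / ev A z (h s)).
  by move=> zX; rewrite mulrA divfK // gt_eqF ?pos.
have r1 := ratio_gt0 _ _ x tk tk' xX; have r2 := ratio_gt0 _ _ x tk' sk xX.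
have Q0 : 0 < Q by apply: lt_le_trans Q1.
rewrite !splitE // (mulrA Q); apply: ltr_pM; [by apply/ltW; rewrite mulr_gt0 | exact: ltW | exact: step |].
by apply: le_lt_trans (IH st tk'); rewrite ler_peMl // ltW.
Qed.

Lemma general_position_generic (R : realType) (d N : nat) (a : dseq R d N)
    (A : nat -> 'cV[R]_d) :
  general_position a -> (forall i : 'I_N, A i = a i) -> generic A (iota 0 N).
Proof.
move=> gp Aa v Y [sY YX] szY v0.
have lt_N (i : 'I_d) : (nth 0%N Y i < N)%N.
  have : nth 0%N Y i \in iota 0 N by apply/YX/mem_nth; rewrite szY.
  by rewrite mem_iota.
pose f (i : 'I_d) := Ordinal (lt_N i).
have inj_f : injective f.
  move=> i j /(congr1 val)/= /eqP; rewrite nth_uniq ?szY //.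
    by move/eqP/val_inj.
  exact: sorted_uniq ltn_trans ltnn _ sY.
have fr := gp f inj_f; set B := [seq a (f i) | i : 'I_d] in fr.
have full : <<B>>%VS = fullv.
  apply/eqP; rewrite eqEdim subvf (eqP fr) size_map size_enum_ord.
  by rewrite dimvf /dim /= muln1.
have vB (u : 'cV[R]_d) : v *m u = 0.
  have : u \in <<B>>%VS by rewrite full memvf.
  move=> /(coord_span (X := in_tuple B))->; rewrite mulmx_sumr big1 // => i _.
  rewrite -scalemxAr; have : B`_i \in B by rewrite mem_nth.
  case/mapP => l _ ->; apply/eqP; rewrite scaler_eq0; apply/orP; right.
  apply/eqP/matrixP => p q; rewrite !ord1 [RHS]mxE.
  by rewrite -Aa; apply: v0; rewrite mem_nth ?szY.
apply/rowP => j; have := congr1 (fun M : 'M_1 => M 0 0) (vB (delta_mx j 0)).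
by rewrite -colE !mxE.
Qed.

Theorem theorem1p3 (R : realType) (q : R) (d : nat) (hq : 1 < q) (hd : (1 < d)%N) :
  forall n : nat, (0 < n)%N ->
  exists N : nat,
    forall a : dseq R d N, general_position a ->
    exists T : 'M[R]_d,
      [/\ T \in unitmx,
          is_trig_mx T
        & exists2 b : dseq R d n,
            subsequence b (fun i => T *m a i) & pseudo_geometric q b].
Proof.
move=> n n0; pose K : R := q + 4 * d%:R.
have d0 : 0 <= d%:R :> R by [].
have K1 : 1 <= K by rewrite /K; lra.
have Kd : 4 * d%:R <= K by rewrite /K; lra.
have KK1 : 1 <= K * K by nra.
have leqK : q <= K by rewrite /K; lra.
have qK : q <= K * K by apply: le_trans leqK _; rewrite ler_peMl //; lra.
have [N hN] := separated_basis n K1 Kd (leqnn d); exists N => a gp.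
pose A i : 'cV[R]_d := if insub i is Some j then a j else 0.
have Aa (i : 'I_N) : A i = a i by rewrite /A valK.
have [|h [sigma [Y [YX szY sepY ldg inj]]]] := hN A (iota 0 N) (iota_ltn_sorted 0 N) _
  (general_position_generic gp Aa); first by rewrite size_iota.
pose sg (t : 'I_d) : 'I_d := Ordinal (ldg t (ltn_ord t)).1.
have [pi sgK piK] : bijective sg.
  by apply: injF_bij => t u /(congr1 val)/inj e; apply/val_inj/e.
have ldg_pi s : last_nonzero_at (h (pi s)) s.
  by have := (ldg (pi s) (ltn_ord _)).2; rewrite -[sigma _]/(val (sg (pi s))) piK.
pose T : 'M[R]_d := \matrix_(s, j) h (pi s) 0 j.
have trigT : is_trig_mx T.
  by apply/is_trig_mxP => s j sj; rewrite mxE; apply: (ldg_pi s j).2.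
have evT s x : (T *m A x) s 0 = ev A x (h (pi s)).
  by rewrite /ev !mxE; apply: eq_bigr => j _; rewrite mxE.
have lt_N (i : 'I_n) : (nth 0%N Y i < N)%N.
  have : nth 0%N Y i \in iota 0 N by apply/(proj2 YX)/mem_nth/(leq_trans _ szY).
  by rewrite mem_iota.
have ltY (i j : 'I_n) : (i < j)%N -> (nth 0%N Y i < nth 0%N Y j)%N.
  by apply: (sorted_ltn_nth ltn_trans _ (proj1 YX)); rewrite inE (leq_trans _ szY).
have inY (i : 'I_n) : nth 0%N Y i \in Y by rewrite mem_nth // (leq_trans _ szY).
have bE (i : 'I_n) s : (T *m a (Ordinal (lt_N i))) s 0 = ev A (nth 0%N Y i) (h (pi s)).
  by rewrite -evT -Aa.
exists T; split=> //.
  rewrite unitmxE unitfE det_trig //; apply/prodf_neq0 => s _; rewrite mxE.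
  exact: (ldg_pi s s).1.
exists (fun i => T *m a (Ordinal (lt_N i))).
  by exists (fun i => Ordinal (lt_N i)) => [i j /ltY|].
split=> [s i | s t st]; first by rewrite bE; apply: (proj1 sepY).
have incr (s' t' : 'I_d) : (pi s' < pi t')%N -> q_increasing q (fun i : 'I_n =>
    (T *m a (Ordinal (lt_N i))) t' 0 / (T *m a (Ordinal (lt_N i))) s' 0).
  move=> st'; have pos i u : 0 < ev A (nth 0%N Y (i : 'I_n)) (h (pi u)).
    by apply: (proj1 sepY).
  split=> [i | i j ji]; rewrite !bE ?divr_gt0 //.
  have ij : (i < j)%N by rewrite ji.
  have growth := separated_rank KK1 sepY st' (ltn_ord _) (inY i) (inY j) (ltY i j ij).
  rewrite ltr_pdivlMr ?divr_gt0 //; apply: le_lt_trans growth.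
  by rewrite ler_pM2r // divr_gt0.
have [/incr|/incr|/val_inj pst] := ltngtP (pi s) (pi t); [by left | by right |].
by move: st; rewrite -(piK s) pst piK eqxx.
Qed.
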